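(* Let $P$ be a $2$-torsion free prime ring with identity $1$ that contains a non-trivial idempotent $e_1$, put $e_2=1-e_1$ and $P_{12}=e_1Pe_2$, and let $D:P\to P$ be a commuting generalized Jordan derivation. If $[D(m)]_{12}=0$ for all $m\in P_{12}$, then $D$ is the zero map.
   Context: Rings are associative and not assumed commutative. A ring $P$ is prime if $p_1 P p_2 = 0$ implies $p_1=0$ or $p_2=0$; it is $2$-torsion free if $2p=0$ with $p\in P$ implies $p=0$. An idempotent $e_1$ ($e_1^2=e_1$) is non-trivial if $e_1\neq 0$ and $e_1\neq 1$. With $P_{ij}=e_iPe_j$ for $i,j\in\{1,2\}$, one has the Peirce decomposition $P=P_{11}+P_{12}+P_{21}+P_{22}$ (a direct sum of additive groups); for $x\in P$, $[x]_{ij}$ denotes the component $e_ixe_j$ of $x$ in $P_{ij}$. A Jordan derivation on $P$ is an additive map $d:P\to P$ with $d(p^2)=d(p)p+pd(p)$ for all $p\in P$. A commuting generalized Jordan derivation on $P$ is an additive map $D:P\to P$ for which there is a Jordan derivation $d$ on $P$ such that $D(p^2)=D(p)p+pd(p)$ and $D(p)p=pD(p)$ for all $p\in P$. *)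

(* Defs.v *)
From mathcomp Require Import all_boot all_algebra.

Set Implicit Arguments.
Unset Strict Implicit.
Unset Printing Implicit Defensive.

Import GRing.Theory.
Local Open Scope ring_scope.

Definition prime_ring (P : pzRingType) : Prop :=
  forall p1 p2 : P, (forall x : P, p1 * x * p2 = 0) -> p1 = 0 \/ p2 = 0.

Definition two_torsion_free (P : pzRingType) : Prop :=
  forall p : P, p *+ 2 = 0 -> p = 0.

Definition nontrivial_idempotent (P : pzRingType) (e : P) : Prop :=
  [/\ e * e = e, e <> 0 & e <> 1].

(* For e = e_i and f = e_j, this is the component [x]_ij of the Peirce
   decomposition. *)
Definition peirce_component (P : pzRingType) (e f x : P) : P := e * x * f.

(* Membership in P_ij = e_i P e_j, with e = e_i and f = e_j. *)
Definition peirce_space (P : pzRingType) (e f m : P) : Prop :=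
  exists x : P, m = e * x * f.

Definition jordan_derivation (P : pzRingType) (d : {additive P -> P}) : Prop :=
  forall p : P, d (p ^+ 2) = d p * p + p * d p.

Definition commuting_generalized_jordan_derivation
    (P : pzRingType) (D : {additive P -> P}) : Prop :=
  exists d : {additive P -> P},
    jordan_derivation d /\
    forall p : P, D (p ^+ 2) = D p * p + p * d p /\ D p * p = p * D p.

(* Main.v *)
Require Import Defs.
From mathcomp Require Import all_boot all_algebra.
Import GRing.Theory.
Local Open Scope ring_scope.

(** Let d be the Jordan derivation attached to D and c = D(1).  Polarizing the
    two defining identities and substituting 1 for one variable gives that c is
    central and that D(x) = c x + d(x) ([commuting_gjd_decomposition]); hence d
    is commuting as well.

    A commuting Jordan derivation kills every idempotent
    ([commuting_jd_idempotent]).  Since e1 + m is idempotent for every m in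
    P12, d vanishes on P12, and by symmetry on P21.  On P11, polarization
    against e1 puts the values of d back in P11, and polarization against P12
    makes them annihilate P12 from the left, so primeness forces them to be 0;
    P22 is symmetric.  The Peirce decomposition then yields d = 0
    ([commuting_jd_eq0]).

    So D is multiplication by the central element c.  The hypothesis on P12 says
    that c e1 P e2 = 0, whence c e1 = 0 and, c being central, c P e1 = 0, so
    that c = 0. *)

(** Stated for a pair, so that D = d gives the polarized Jordan identity. *)
Lemma gjd_polarization {P : pzRingType} {D d : {additive P -> P}} :
    (forall p, D (p ^+ 2) = D p * p + p * d p) ->
  forall x y, D (x * y + y * x) = (D x * y + D y * x) + (x * d y + y * d x).
Proof.
move=> Dsq x y.
have := Dsq (x + y).
rewrite expr2 mulrDl !mulrDr !raddfD /= -!expr2 !Dsq !mulrDl !mulrDr.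
set a := D x * x; set b := x * d x; set u := D y * y; set v := y * d y.
set s := D x * y; set t := D y * x; set r := x * d y; set q := y * d x.
move=> /(congr1 (fun z => z - (a + b) - (u + v))).
have -> : a + b + D (x * y) + (D (y * x) + (u + v)) - (a + b) - (u + v)
          = D (x * y) + D (y * x).
  by rewrite -(addrA (a + b)) [a + b + _]addrC addrK addrA addrK.
move=> ->.
rewrite (AC ((2*2)*(2*2)) (((3*2)*(6*7))*((4*8)*(1*5)))) /=.
by rewrite [_ + (u + v + _)]addrA !addrK.
Qed.

Lemma commuting_polarization {P : pzRingType} {d : {additive P -> P}} :
    (forall p, d p * p = p * d p) ->
  forall x y, d x * y + d y * x = x * d y + y * d x.
Proof.
move=> dC x y.
have := dC (x + y).
rewrite !raddfD /= !mulrDl !mulrDr (dC x) (dC y).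
rewrite -!addrA => /addrI; rewrite !addrA => /addIr.
by rewrite addrC [RHS]addrC.
Qed.

(** Substituting y = 1 in the polarized commuting identity gives the first
    part.  The generalized Jordan identity at p = 1 gives d(1) = 0, and its
    polarization at y = 1 is then D(x) + D(x) = D(x) + (D(1) x + d(x)). *)
Lemma commuting_gjd_decomposition {P : pzRingType} {D d : {additive P -> P}} :
    (forall p, D (p ^+ 2) = D p * p + p * d p) ->
    (forall p, D p * p = p * D p) ->
  (forall x, D 1 * x = x * D 1) /\ (forall x, D x = D 1 * x + d x).
Proof.
move=> Dsq DC; split=> x.
  by have := commuting_polarization DC x 1; rewrite mulr1 mul1r [RHS]addrC => /addrI.
have d1 : d 1 = 0.
  have := Dsq 1; rewrite expr1n mulr1 mul1r -[LHS]addr0.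
  by move=> /addrI.
have := gjd_polarization Dsq x 1.
by rewrite mulr1 mul1r raddfD d1 mulr0 mulr1 mul1r add0r -addrA => /addrI.
Qed.

(** With a = d(e), the identities give a = 2 e a, so e a = 2 e a, hence
    e a = 0 and a = 0. *)
Lemma commuting_jd_idempotent {P : pzRingType} {d : {additive P -> P}} {e : P} :
    jordan_derivation d -> (forall p, d p * p = p * d p) ->
  e * e = e -> d e = 0.
Proof.
move=> dJ dC ee.
have de : d e = e * d e + e * d e by rewrite -[LHS](congr1 d ee) -expr2 dJ dC.
have ed0 : e * d e = 0.
  have := congr1 ( *%R e) de; rewrite mulrDr mulrA ee -[LHS]addr0.
  by move=> /addrI.
by rewrite de ed0 addr0.
Qed.

(** The element e + e x f is idempotent, so [commuting_jd_idempotent] applies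
    to both summands of d(e x f) = d(e + e x f) - d(e). *)
Lemma commuting_jd_offdiag {P : pzRingType} {d : {additive P -> P}} {e f : P} :
    jordan_derivation d -> (forall p, d p * p = p * d p) ->
    e * e = e -> f * e = 0 ->
  forall x, d (e * x * f) = 0.
Proof.
move=> dJ dC ee fe x.
have: d (e + e * x * f) = 0.
  apply: commuting_jd_idempotent => //.
  by rewrite mulrDl !mulrDr !mulrA ee -(mulrA (e * x) f e) fe mulr0 !mul0r !addr0.
by rewrite raddfD /= (commuting_jd_idempotent dJ dC ee) add0r.
Qed.

(** Polarizing against e, where d vanishes, gives 2 a = 2 e a and a e = e a for
    a = d(e x e); without 2-torsion a lies in e P e.  Polarizing against e w f,
    where d vanishes too, gives a w f = a (e w f) = (e w f) a, which is 0
    because f e = 0. *)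
Lemma commuting_jd_diag {P : pzRingType} {d : {additive P -> P}} {e f : P} :
    two_torsion_free P -> prime_ring P ->
    jordan_derivation d -> (forall p, d p * p = p * d p) ->
    e * e = e -> f * e = 0 -> f <> 0 ->
  forall x, d (e * x * e) = 0.
Proof.
move=> P2 Pp dJ dC ee fe f0 x.
have de := commuting_jd_idempotent dJ dC ee.
set y := e * x * e; set a := d y.
have ae : a * e = e * a.
  by have := commuting_polarization dC y e; rewrite de mul0r mulr0 addr0 add0r.
have ea : a = e * a.
  apply/eqP; rewrite -subr_eq0; apply/eqP/P2.
  have := gjd_polarization dJ y e.
  rewrite de mul0r mulr0 addr0 add0r -/a ae /y -mulrA ee !mulrA ee -mulrA.
  by rewrite mulrA -/y raddfD -/a mulrnBl !mulr2n => ->; rewrite subrr.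
have [w||//] := Pp a f; last by [].
have := commuting_polarization dC y (e * w * f).
rewrite (commuting_jd_offdiag dJ dC ee fe) mul0r mulr0 addr0 add0r -/a.
by rewrite {2}ea !mulrA ae -ea -(mulrA (e * w)) fe mulr0 mul0r.
Qed.

(** Some hypothesis of noncommutativity is needed, since every derivation of a
    field is commuting; it is the idempotent that supplies it.  The proof cuts
    x into its four Peirce components and treats e and 1 - e symmetrically. *)
Lemma commuting_jd_eq0 {P : pzRingType} {d : {additive P -> P}} {e : P} :
    two_torsion_free P -> prime_ring P -> nontrivial_idempotent e ->
    jordan_derivation d -> (forall p, d p * p = p * d p) ->
  forall x, d x = 0.
Proof.
move=> P2 Pp [ee e0 e1] dJ dC x.
pose f := 1 - e.
have fe : f * e = 0 by rewrite mulrBl mul1r ee subrr.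
have ef : e * f = 0 by rewrite mulrBr mulr1 ee subrr.
have ff : f * f = f by rewrite {2}/f mulrBr mulr1 fe subr0.
have f0 : f <> 0 by move/eqP; rewrite subr_eq0 => /eqP/esym.
have -> : x = e * x * e + e * x * f + (f * x * e + f * x * f).
  by rewrite -!mulrDr [e + f]addrC subrK !mulr1 -mulrDl [e + f]addrC subrK mul1r.
rewrite !raddfD /=.
rewrite (commuting_jd_diag P2 Pp dJ dC ee fe f0).
rewrite (commuting_jd_diag P2 Pp dJ dC ff ef e0).
rewrite (commuting_jd_offdiag dJ dC ee fe) (commuting_jd_offdiag dJ dC ff ef).
by rewrite !addr0.
Qed.

Theorem corollary3p6 (P : pzRingType) (e1 : P) (D : {additive P -> P})
    (P_torsion : two_torsion_free P) (P_prime : prime_ring P)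
    (e1_idem : nontrivial_idempotent e1)
    (D_cgjd : commuting_generalized_jordan_derivation D) :
  let e2 := 1 - e1 in
  (forall m : P, peirce_space e1 e2 m -> peirce_component e1 e2 (D m) = 0) ->
  forall p : P, D p = 0.
Proof.
move=> e2 D12.
have [d [dJ Dd]] := D_cgjd.
have Dsq p := (Dd p).1.
have DC p := (Dd p).2.
have [cC Dcd] := commuting_gjd_decomposition Dsq DC.
have dC p : d p * p = p * d p.
  have := DC p; rewrite (Dcd p) mulrDl mulrDr mulrA -(cC p).
  by move=> /addrI.
have d0 := commuting_jd_eq0 P_torsion P_prime e1_idem dJ dC.
have Dc p : D p = D 1 * p by rewrite Dcd d0 addr0.
have [ee e0 e_neq1] := e1_idem.
have e22 : e2 * e2 = e2.
  by rewrite /e2 mulrBr mulr1 mulrBl mul1r ee subrr subr0.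
have ce0 : D 1 * e1 = 0.
  have [x||e20] := P_prime (D 1 * e1) e2; [|by []|].
    have := D12 (e1 * x * e2) (ex_intro _ x erefl).
    rewrite /peirce_component Dc !mulrA -cC -(mulrA (D 1)) ee.
    by rewrite -mulrA e22.
  by case: e_neq1; move/eqP: e20; rewrite subr_eq0 => /eqP/esym.
have [x|c0|//] := P_prime (D 1) e1.
  by rewrite cC -mulrA ce0 mulr0.
by move=> p; rewrite Dc c0 mul0r.
Qed.
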